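(* Let $J,A$ be sets. For all $\vec u:\mathsf{List}(J)$, all $\alpha:\mathbb{N}\to J$ and all $\mathfrak a:\mathcal{E}(\mathbb{N},J,A)$, $$\mathsf{exec}_{\mathcal{E}}(\mathfrak a,\ \vec u\cdot\alpha)=\mathsf{exec}_{\mathcal{B}}(\mathsf{norm}_{\vec u}(\mathfrak a),\ \alpha).$$ In particular, for $\vec u=[\,]$, $\mathsf{exec}_{\mathcal{E}}(\mathfrak a,\alpha)=\mathsf{exec}_{\mathcal{B}}(\mathsf{norm}_{[\,]}(\mathfrak a),\alpha)$ for every dialogue $\mathfrak a$.
   Context: Setting: constructive metatheory with function extensionality. $\mathsf{List}(J)$: finite lists; $[\,]$ the empty list; $j::\vec v$ has head $j$ and tail $\vec v$; $\vec u\cdot j$ is $\vec u$ with $j$ appended at the end. For $\vec u:\mathsf{List}(J)$ and $\alpha:\mathbb{N}\to J$, $\vec u\cdot\alpha:\mathbb{N}\to J$ is the sequence consisting of $\vec u$ followed by $\alpha$. $\mathsf{head}(\alpha)=\alpha(0)$ and $\mathsf{tail}(\alpha)(n)=\alpha(n+1)$. Escardó dialogues. For sets $I,J,A$, $\mathcal{E}(I,J,A)$ is the inductive set with constructors $\mathsf{ret}(a)$ for $a:A$, and $\mathsf{query}(i,\mathfrak a)$ for $i:I$ and $\mathfrak a:J\to\mathcal{E}(I,J,A)$. Execution against $\alpha:I\to J$: $\mathsf{exec}_{\mathcal{E}}(\mathsf{ret}(a),\alpha)=a$, $\mathsf{exec}_{\mathcal{E}}(\mathsf{query}(i,\mathfrak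 a),\alpha)=\mathsf{exec}_{\mathcal{E}}(\mathfrak a(\alpha(i)),\alpha)$. Brouwerian dialogues. For sets $J,A$, $\mathcal{B}(J,A)$ is the inductive set with constructors $\mathsf{spit}(a)$ for $a:A$, and $\mathsf{bite}(\mathbf a)$ for $\mathbf a:J\to\mathcal{B}(J,A)$. Execution against $\alpha:\mathbb{N}\to J$: $\mathsf{exec}_{\mathcal{B}}(\mathsf{spit}(a),\alpha)=a$, $\mathsf{exec}_{\mathcal{B}}(\mathsf{bite}(\mathbf a),\alpha)=\mathsf{exec}_{\mathcal{B}}(\mathbf a(\mathsf{head}(\alpha)),\mathsf{tail}(\alpha))$. Normalization. Two relations are defined by mutual induction: $\vec u\Vdash\mathfrak a\Downarrow\mathbf a$ (with $\vec u:\mathsf{List}(J)$, $\mathfrak a:\mathcal{E}(\mathbb{N},J,A)$, $\mathbf a:\mathcal{B}(J,A)$), and $\vec u\Vdash\langle i,\mathfrak a\rangle;\vec v\Downarrow\mathbf a$ (with $\vec u,\vec v:\mathsf{List}(J)$, $i:\mathbb{N}$, $\mathfrak a:J\to\mathcal{E}(\mathbb{N},J,A)$, $\mathbf a:\mathcal{B}(J,A)$), generated by the rules: 1. $\vec u\Vdash\mathsf{ret}(a)\Downarrow\mathsf{spit}(a)$. 2. If $\vec u\Vdash\langle i,\mathfrak a\rangle;\vec u\Downarrow\mathbf a$, then $\vec u\Vdash\mathsf{query}(i,\mathfrak a)\Downarrow\mathbf a$. 3. If $\vec u\Vdash\mathfrak a(j)\Downarrow\mathbf a$, then $\vec u\Vdash\langle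 0,\mathfrak a\rangle;(j::\vec v)\Downarrow\mathbf a$. 4. If $\vec u\Vdash\langle i,\mathfrak a\rangle;\vec v\Downarrow\mathbf a$, then $\vec u\Vdash\langle i+1,\mathfrak a\rangle;(j::\vec v)\Downarrow\mathbf a$. 5. If for all $j:J$, $\vec u\cdot j\Vdash\mathfrak a(j)\Downarrow\mathbf a(j)$, then $\vec u\Vdash\langle 0,\mathfrak a\rangle;[\,]\Downarrow\mathsf{bite}(\mathbf a)$. 6. If for all $j:J$, $\vec u\cdot j\Vdash\langle i,\mathfrak a\rangle;[\,]\Downarrow\mathbf a(j)$, then $\vec u\Vdash\langle i+1,\mathfrak a\rangle;[\,]\Downarrow\mathsf{bite}(\mathbf a)$. The first relation is functional: for each $\vec u,\mathfrak a$ there is a unique $\mathbf a$ with $\vec u\Vdash\mathfrak a\Downarrow\mathbf a$; this $\mathbf a$ is denoted $\mathsf{norm}_{\vec u}(\mathfrak a)$. *)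

(* Defs.v *)
From Stdlib Require Import List FunctionalExtensionality.
Import ListNotations.

Set Implicit Arguments.
Unset Strict Implicit.

Definition head (J : Type) (alpha : nat -> J) : J := alpha 0.

Definition tail (J : Type) (alpha : nat -> J) : nat -> J := fun n => alpha (S n).

Fixpoint prepend (J : Type) (u : list J) (alpha : nat -> J) : nat -> J :=
  match u with
  | [] => alpha
  | j :: v => fun n => match n with 0 => j | S m => prepend v alpha m end
  end.

Definition snoc (J : Type) (u : list J) (j : J) : list J := u ++ [j].

Inductive escardo (I J A : Type) : Type :=
| ret (a : A)
| query (i : I) (k : J -> escardo I J A).

Arguments ret {I J A} a.
Arguments query {I J A} i k.

Fixpoint exec_E (I J A : Type) (d : escardo I J A) (alpha : I -> J) : A :=
  match d with
  | ret a => a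
  | query i k => exec_E (k (alpha i)) alpha
  end.

Inductive brouwer (J A : Type) : Type :=
| spit (a : A)
| bite (k : J -> brouwer J A).

Arguments spit {J A} a.
Arguments bite {J A} k.

Fixpoint exec_B (J A : Type) (b : brouwer J A) (alpha : nat -> J) : A :=
  match b with
  | spit a => a
  | bite k => exec_B (k (head alpha)) (tail alpha)
  end.

(** [normalizes u d b] is [u ||- d ⇓ b]; [answers u i k v b] is
    [u ||- <i, k>; v ⇓ b]. *)
Inductive normalizes (J A : Type) :
  list J -> escardo nat J A -> brouwer J A -> Prop :=
| normalizes_ret u a :
    normalizes u (ret a) (spit a)
| normalizes_query u i k b :
    answers u i k u b ->
    normalizes u (query i k) b
with answers (J A : Type) :
  list J -> nat -> (J -> escardo nat J A) -> list J -> brouwer J A -> Prop :=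
| answers_0_cons u k j v b :
    normalizes u (k j) b ->
    answers u 0 k (j :: v) b
| answers_S_cons u i k j v b :
    answers u i k v b ->
    answers u (S i) k (j :: v) b
| answers_0_nil u k b :
    (forall j, normalizes (snoc u j) (k j) (b j)) ->
    answers u 0 k [] (bite b)
| answers_S_nil u i k b :
    (forall j, answers (snoc u j) i k [] (b j)) ->
    answers u (S i) k [] (bite b).

Lemma normalizes_total (J A : Type) (d : escardo nat J A) (u : list J) :
  {b : brouwer J A | normalizes u d b}.
Proof.
  revert u; induction d as [a | i k IH]; intros u.
  - exists (spit a). constructor.
  - enough (H : forall v i u, {b : brouwer J A | answers u i k v b}).
    { destruct (H u i u) as [b Hb]. exists b. now constructor. }
    clear i u. induction v as [| j v IHv].
    + induction i as [| i IHi]; intros u.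
      * exists (bite (fun j => proj1_sig (IH j (snoc u j)))).
        constructor; intros j. exact (proj2_sig (IH j (snoc u j))).
      * exists (bite (fun j => proj1_sig (IHi (snoc u j)))).
        constructor; intros j. exact (proj2_sig (IHi (snoc u j))).
    + intros [| i] u.
      * destruct (IH j u) as [b Hb]. exists b. now constructor.
      * destruct (IHv i u) as [b Hb]. exists b. now constructor.
Defined.

Lemma normalizes_functional (J A : Type) (u : list J) (d : escardo nat J A)
    (b b' : brouwer J A) :
  normalizes u d b -> normalizes u d b' -> b = b'.
Proof.
  revert u b b'; induction d as [a | i k IH]; intros u b b' H H'.
  - inversion H; inversion H'; congruence.
  - assert (K : forall v i u b b',
               answers u i k v b -> answers u i k v b' -> b = b').
    { clear i u b b' H H'. induction v as [| j v IHv].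
      - induction i as [| i IHi]; intros u b b' H H';
          inversion H; inversion H'; subst; f_equal;
          apply functional_extensionality; intros j; eauto.
      - intros [| i] u b b' H H'; inversion H; inversion H'; subst; eauto. }
    inversion H; inversion H'; subst; eauto.
Qed.

Definition norm (J A : Type) (u : list J) (d : escardo nat J A) : brouwer J A :=
  proj1_sig (normalizes_total d u).

Lemma norm_unique (J A : Type) (u : list J) (d : escardo nat J A) :
  unique (normalizes u d) (norm u d).
Proof.
  split.
  - exact (proj2_sig (normalizes_total d u)).
  - intros b. apply normalizes_functional. exact (proj2_sig (normalizes_total d u)).
Qed.

(* Main.v *)
Require Import Defs.
From Stdlib Require Import List FunctionalExtensionality.
Import ListNotations.

(* The default principles give no induction hypothesis across the two mutual relations. *)
Scheme normalizes_answers_ind := Minimality for normalizes Sort Prop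
  with answers_normalizes_ind := Minimality for answers Sort Prop.

(** A [bite] only moves the head of [alpha] into the known prefix, so the oracle seen by [exec_E]
    stays the same. *)
Lemma prepend_snoc_head_tail (J : Type) (u : list J) (alpha : nat -> J) :
  prepend (snoc u (Defs.head alpha)) (Defs.tail alpha) = prepend u alpha.
Proof.
  induction u as [| j u IH]; apply functional_extensionality; intros [| n];
    try reflexivity.
  exact (f_equal (fun f => f n) IH).
Qed.

(* For [answers u i k v b] the invariant has to be that [v] is what is left of
   the known prefix after [i] has been decreased in step with it, so the pending
   query is answered by entry [i] of [prepend v alpha], while the continuation
   still runs against all of [prepend u alpha]. *)
Lemma normalizes_exec (J A : Type) (u : list J) (d : escardo nat J A)
    (b : brouwer J A) :
  normalizes u d b ->
  forall alpha, exec_E d (prepend u alpha) = exec_B b alpha.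
Proof.
  intros H.
  induction H using normalizes_answers_ind with
    (P0 := fun u i k v b => forall alpha,
       exec_E (k (prepend v alpha i)) (prepend u alpha) = exec_B b alpha);
    intros alpha; simpl; auto.
  - rewrite <- (prepend_snoc_head_tail _ u alpha). auto.
  - rewrite <- (prepend_snoc_head_tail _ u alpha).
    (* The index drops by one as the head is consumed: [tail alpha i] is [alpha (S i)] by
       conversion. *)
    match goal with IH : forall j alpha, exec_E _ _ = _ |- _ =>
      exact (IH (Defs.head alpha) (Defs.tail alpha)) end.
Qed.

Theorem lemma3p4 (J A : Type) :
  (forall (u : list J) (alpha : nat -> J) (d : escardo nat J A),
      exec_E d (prepend u alpha) = exec_B (norm u d) alpha) /\
  (forall (alpha : nat -> J) (d : escardo nat J A),
      exec_E d alpha = exec_B (norm [] d) alpha).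
Proof.
  assert (H : forall (u : list J) (alpha : nat -> J) (d : escardo nat J A),
             exec_E d (prepend u alpha) = exec_B (norm u d) alpha).
  { intros u alpha d. apply normalizes_exec, norm_unique. }
  (* [prepend [] alpha] computes to [alpha]. *)
  split; [exact H | exact (H [])].
Qed.
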